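(* Let $(M,F)$ be a Finsler manifold admitting a concurrent $\pi$-vector field $\overline\varphi$ with associated $\pi$-form $\phi=i_{\overline\varphi}g$; put $\Phi=\phi(\overline\eta)$ and $p^2=g(\overline\varphi,\overline\varphi)$. Let $\widehat F=\frac{F^2}{F-\Phi}$ on $\mathcal D=\{(x,y)\in TM : F(x,y)>\Phi(x,y)\}$ be a generalized $\phi$-Matsumoto metric (i.e. a conic pseudo-Finsler structure), with $F(1+2p^2)-3\Phi\neq0$ on $\mathcal D$. If $F$ is a rational Finsler metric, then the following assertions are equivalent: (a) $F$ is a rational function in $y$; (b) $\widehat F$ is a rational Finsler metric.
   Context: $M$ is an $n$-dimensional paracompact smooth manifold, $\pi:TM\to M$, $\mathcal TM=TM\setminus\{0\}$, with natural coordinates $(x^i,y^i)$; ''rational in $y$'' means that, for fixed $x$, the function is a rational function of the fibre coordinates $y=(y^1,\dots,y^n)$ (on the domain considered). Almost rational / rational Finsler metric: a (conic) Finsler metric on a conic domain $\mathcal D$ is almost rational if its metric components $g_{ij}$ (half the $y$-Hessian of the square of the metric function) can be written $g_{ij}(x,y)=\theta(x,y)\,a_{ij}(x,y)$ with $\theta:\mathcal D\to(0,\infty)$ smooth, $(a_{ij}(x,y))$ symmetric and non-degenerate, and each $a_{ij}$ rational in $y$. If moreover $\theta$ is rational in $y$, it is a rational Finsler metric. $\pi$-vector fields are smooth sections of the pullback of $TM\to M$ over $\mathcal TM$ (local basis $\overline{\partial}_i$). $\gamma(W^i\overline\partial_i)=W^i\partial_{y^i}$, $\rho(a^i\partial_{x^i}+b^i\partial_{y^i})=a^i\overline\partial_i$,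 $J=\gamma\circ\rho$, $\overline\eta=y^i\overline\partial_i$, $\mathcal C=\gamma\overline\eta$, $d_Jf=df\circ J$. Finsler structure: $F:TM\to[0,\infty)$, $C^\infty$ on $\mathcal TM$, $C^0$ on $TM$, positively homogeneous of degree 1 in $y$, with $dd_JE$ of maximal rank, $E=\frac12F^2$. Metric tensor: $g(\rho W,\rho Z)=dd_JE(JW,Z)$. Geodesic spray $G$: $JG=\mathcal C$, $[\mathcal C,G]=G$, $i_Gdd_JE=-dE$. Barthel connection $\Gamma=[J,G]$ (i.e. $\Gamma X=[JX,G]-J[X,G]$), $h=\frac12(I+\Gamma)$, $v=\frac12(I-\Gamma)$, $\beta=(\rho|_{\mathrm{Im}\,h})^{-1}$. Berwald connection $D^\circ$: $\gamma D^\circ_{hZ}\rho W=v[hZ,JW]$, $D^\circ_{\gamma\overline Z}\overline W=\rho[\gamma\overline Z,\beta\overline W]$. Cartan connection $\nabla$: determined by $2g(\nabla_{\gamma\overline X}\overline Y,\overline Z)=\gamma\overline X\cdot g(\overline Y,\overline Z)+g(\overline Y,\rho[\beta\overline Z,\gamma\overline X])+g(\overline Z,\rho[\gamma\overline X,\beta\overline Y])$ and $2g(\nabla_{\beta\overline X}\overline Y,\overline Z)=\beta\overline X\cdot g(\overline Y,\overline Z)+\beta\overline Y\cdot g(\overline Z,\overline X)-\beta\overline Z\cdot g(\overline X,\overline Y)-g(\overline X,\rho[\beta\overline Y,\beta\overline Z])+g(\overline Y,\rho[\beta\overline Z,\beta\overline X])+g(\overline Z,\rho[\beta\overline X,\beta\overline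 Y])$. Concurrent $\pi$-vector field: a non-vanishing $\pi$-vector field $\overline\varphi$ with $\nabla_{\beta\overline W}\overline\varphi=-\overline W=D^\circ_{\beta\overline W}\overline\varphi$ and $\nabla_{\gamma\overline W}\overline\varphi=0=D^\circ_{\gamma\overline W}\overline\varphi$ for all $\overline W$. Conic pseudo-Finsler structure on $M$: a smooth function to $[0,\infty)$ on a conic sub-bundle $\mathcal D\subset\mathcal TM$ (non-empty, open, invariant under scaling by positive reals, $\pi(\mathcal D)=M$, each fibre $\mathcal D_x$ connected), positively 1-homogeneous in $y$, whose form $dd_J(\frac12(\cdot)^2)$ has maximal rank. *)

(* Defs.v *)
From HB Require Import structures.
From mathcomp Require Import all_boot all_order all_algebra.
From mathcomp Require Import all_classical all_reals all_analysis.
(* Not imported: the notations of mpoly clash with those of analysis. *)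
From mathcomp Require mpoly.

Set Implicit Arguments.
Unset Strict Implicit.
Unset Printing Implicit Defensive.

Import Order.TTheory GRing.Theory Num.Theory.
Import numFieldNormedType.Exports.

Local Open Scope classical_set_scope.
Local Open Scope ring_scope.

(** ** Smooth maps on open sets *)

(* [Ck_on k f U] is the usual class C^k when [U] is open in a
   finite-dimensional space; it is only used there. *)
Fixpoint Ck_on (R : realType) (V W : normedModType R) (k : nat)
    (f : V -> W) (U : set V) : Prop :=
  match k with
  | 0 => forall x, U x -> {for x, continuous f}
  | k'.+1 => (forall x, U x -> differentiable f x) /\
             (forall v : V, Ck_on k' (fun x => 'd f x v) U)
  end.

Definition smooth_on (R : realType) (V W : normedModType R)
    (f : V -> W) (U : set V) : Prop := forall k, Ck_on k f U.

Lemma diff_near_comp (R : realType) (U V W : normedModType R)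
    (f : U -> V) (g : V -> W) (h : U -> W) (x : U) (fx : V) :
  f x = fx -> differentiable f x -> differentiable g fx -> differentiable h x ->
  (\forall u \near x, h u = g (f u)) ->
  forall y, 'd h x y = 'd g fx ('d f x y).
Proof.
move=> <- df dg dh hgf y.
have dgf : differentiable (g \o f) x by exact: differentiable_comp.
have e : 'd (g \o f) x y = 'd g (f x) ('d f x y) by rewrite diff_comp.
rewrite -e -(deriveE y dh) -(deriveE y dgf).
exact: near_eq_derive.
Qed.

(** ** Manifolds *)

Definition paracompact (T : topologicalType) : Prop :=
  forall U : set (set T), U `<=` open -> \bigcup_(A in U) A = setT ->
  exists V : set (set T),
    [/\ V `<=` open, \bigcup_(B in V) B = setT,
        forall B, V B -> exists2 A, U A & B `<=` A &
        forall x : T, exists2 N, nbhs x N &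
          finite_set [set B | V B /\ B `&` N !=set0]].

Record manifold (R : realType) (n : nat) := Manifold {
  mspace :> topologicalType ;
  atlas : Type ;
  dom : atlas -> set mspace ;
  chart : atlas -> mspace -> 'rV[R]_n ;
  chartV : atlas -> 'rV[R]_n -> mspace ;
  mspace_hausdorff : hausdorff_space mspace ;
  mspace_paracompact : paracompact mspace ;
  dom_cover : forall x, exists i, dom i x ;
  dom_open : forall i, open (dom i) ;
  chart_open : forall i, open (chart i @` dom i) ;
  chartK : forall i x, dom i x -> chartV i (chart i x) = x ;
  chart_continuous : forall i x, dom i x -> {for x, continuous (chart i)} ;
  chartV_continuous : forall i x, dom i x ->
    {for chart i x, continuous (chartV i)} ;
  transition_smooth : forall i j,
    smooth_on (chart j \o chartV i) (chart i @` (dom i `&` dom j)) }.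

Section TangentBundle.
Context {R : realType} {n : nat} {M : manifold R n}.
Implicit Types (i j k : atlas M) (x : M).

Definition transition i j : 'rV[R]_n -> 'rV[R]_n := chart j \o chartV i.

Definition cimage i : set 'rV[R]_n := chart i @` dom i.

(* A tangent vector at [x] is given by its components in all the charts around
   [x], related by the Jacobians of the transition maps. *)
Definition tangent_law x (w : atlas M -> 'rV[R]_n) : Prop :=
  (forall i, ~ dom i x -> w i = 0) /\
  (forall i j, dom i x -> dom j x ->
     w j = 'd (transition i j) (chart i x) (w i)).

Record tangent := Tangent {
  base : M ;
  comp : atlas M -> 'rV[R]_n ;
  compP : tangent_law base comp }.

Definition vec_comp i x (y : 'rV[R]_n) : atlas M -> 'rV[R]_n :=
  fun j => if `[< dom i x /\ dom j x >]
           then 'd (transition i j) (chart i x) y else 0.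

Lemma transition_differentiable i j x : dom i x -> dom j x ->
  differentiable (transition i j) (chart i x).
Proof.
move=> ix jx; have [+ _] := transition_smooth i j 1%N.
by apply; exists x.
Qed.

Lemma near_dom i j x : dom i x -> dom j x ->
  \forall u \near chart i x, dom j (chartV i u).
Proof.
move=> ix jx; have := chartV_continuous ix; apply.
rewrite (chartK ix); apply: open_nbhs_nbhs; split => //; exact: dom_open.
Qed.

Lemma transition_comp i j k x : dom i x -> dom j x -> dom k x ->
  forall y, 'd (transition i k) (chart i x) y =
  'd (transition j k) (chart j x) ('d (transition i j) (chart i x) y).
Proof.
move=> ix jx kx y.
have tij : transition i j (chart i x) = chart j x.
  by rewrite /transition /= chartK.
move: y; apply: (diff_near_comp tij); [exact: transition_differentiable..|].
near=> u; have jxu : dom j (chartV i u) by near: u; exact: near_dom.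
by rewrite /transition /= (chartK jxu).
Unshelve. all: by end_near. Qed.

Lemma vec_compP i x y : tangent_law x (vec_comp i x y).
Proof.
split=> [j njx|j k jx kx]; first by rewrite /vec_comp asboolF // => -[].
rewrite /vec_comp; have [ix|nix] := pselect (dom i x).
  by rewrite !asboolT //; exact: transition_comp.
by rewrite !asboolF ?linear0 // => -[].
Qed.

(* Natural coordinates [(x^i, y^i)] on [TM]: [coords i] and its inverse
   [tvec i], defined on [cimage i `*` setT]. *)
Definition tvec i (z : 'rV[R]_n * 'rV[R]_n) : tangent :=
  Tangent (vec_compP i (chartV i z.1) z.2).

Definition coords i (v : tangent) : 'rV[R]_n * 'rV[R]_n :=
  (chart i (base v), comp v i).

Lemma tscaleP (c : R) (v : tangent) :
  tangent_law (base v) (fun i => c *: comp v i).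
Proof.
have [v0 vl] := compP v; split=> [i ix|i j ix jx]; first by rewrite v0 ?scaler0.
by rewrite linearZ /= -vl.
Qed.

Definition tscale (c : R) (v : tangent) : tangent := Tangent (tscaleP c v).

(* The slit bundle [TM \ 0], globally and in the coordinates of a chart. *)
Definition slit : set tangent := [set v | exists i, comp v i != 0].

Definition slit_chart i : set ('rV[R]_n * 'rV[R]_n) :=
  [set z | cimage i z.1 /\ z.2 != 0].

Definition in_chart (D : set tangent) i : set ('rV[R]_n * 'rV[R]_n) :=
  [set z | cimage i z.1 /\ D (tvec i z)].

Definition fibre (D : set tangent) i (u : 'rV[R]_n) : set 'rV[R]_n :=
  [set y | D (tvec i (u, y))].

Definition smooth_fun (f : tangent -> R) (D : set tangent) : Prop :=
  forall i, smooth_on (f \o tvec i) (in_chart D i).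

(* [TM] carries the topology which makes its natural charts homeomorphisms. *)
Definition topen (D : set tangent) : Prop := forall i, open (in_chart D i).

Definition tcontinuous (f : tangent -> R) : Prop :=
  forall i z, cimage i z.1 -> {for z, continuous (f \o tvec i)}.

Definition ttransition i j (z : 'rV[R]_n * 'rV[R]_n) : 'rV[R]_n * 'rV[R]_n :=
  coords j (tvec i z).

(* A vector field on [TM \ 0], by its components [(a^i, b^i)] in the natural
   coordinates of each chart. *)
Definition slit_vector_field
    (X : atlas M -> 'rV[R]_n * 'rV[R]_n -> 'rV[R]_n * 'rV[R]_n) : Prop :=
  (forall i, smooth_on (X i) (slit_chart i)) /\
  (forall i j z, slit_chart i z -> dom j (chartV i z.1) ->
     X j (ttransition i j z) = 'd (ttransition i j) z (X i z)).

Definition pi_comp (W : tangent -> tangent) i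
    (z : 'rV[R]_n * 'rV[R]_n) : 'rV[R]_n := comp (W (tvec i z)) i.

Definition pi_vector_field (W : tangent -> tangent) : Prop :=
  (forall v, slit v -> base (W v) = base v) /\
  (forall i, smooth_on (pi_comp W i) (slit_chart i)).

End TangentBundle.

Arguments tangent {R n} M.

(** ** The pullback formalism in natural coordinates [z = (x, y)] *)

Section PullbackFormalism.
Context {R : realType} {n : nat}.
Local Notation vec := 'rV[R]_n.
Local Notation pt := ('rV[R]_n * 'rV[R]_n)%type.
Implicit Types (z a b : pt) (f E : pt -> R) (X Y Z G : pt -> pt)
  (W U A phi : pt -> vec) (O : set pt).

Definition gam (w : vec) : pt := (0, w).
Definition rho (a : pt) : vec := a.1.
Definition Jvert (a : pt) : pt := gam (rho a).
Definition eta (z : pt) : vec := z.2.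
Definition liouville (z : pt) : pt := gam (eta z).

Definition bracket X Y : pt -> pt := fun z => 'd Y z (X z) - 'd X z (Y z).

(* 1-forms are maps [pt -> pt -> R], linear in the second argument; in
   coordinates d omega (a, b) = a . omega(b) - b . omega(a) for constant
   [a], [b]. *)
Definition ext_d (omega : pt -> pt -> R) : pt -> pt -> pt -> R :=
  fun z a b => 'd (omega ^~ b) z a - 'd (omega ^~ a) z b.
Definition d_J f : pt -> pt -> R := fun z a => 'd f z (Jvert a).
Definition ddJ E : pt -> pt -> pt -> R := ext_d (d_J E).

Definition max_rank (omega : pt -> pt -> R) : Prop :=
  forall a, (forall b, omega a b = 0) -> a = 0.

(* g(rho W, rho Z) = dd_J E (J W, Z), independent of the lifts. *)
Definition gmetric E z (w1 w2 : vec) : R := ddJ E z (Jvert (w1, 0)) (w2, 0).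

Definition hess E z : 'M[R]_n :=
  \matrix_(k, l) 'd (fun z' => 'd E z' (gam (delta_mx 0 l))) z
                    (gam (delta_mx 0 k)).

Definition geodesic_spray_on E G O : Prop :=
  [/\ forall z, O z -> Jvert (G z) = liouville z,
      forall z, O z -> bracket liouville G z = G z &
      forall z, O z -> forall a, ddJ E z (G z) a = - 'd E z a].

Definition barthel G X : pt -> pt :=
  fun z => bracket (Jvert \o X) G z - Jvert (bracket X G z).
Definition hproj G X : pt -> pt := fun z => 2^-1 *: (X z + barthel G X z).
Definition vproj G X : pt -> pt := fun z => 2^-1 *: (X z - barthel G X z).

(* The inverse of [rho] on the image of [h]: as [h] kills vertical vectors and
   [rho \o h = rho], it is [h] of an arbitrary lift. *)
Definition beta G W : pt -> pt := hproj G (fun z => (W z, 0)).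

(* [A] is the covariant derivative of [U] in the direction [beta W],
   resp. [gam W], for the Berwald and for the Cartan connection. The test fields
   are the smooth local sections over [O], later the slit bundle over a chart
   domain: both connections are local operators. *)
Definition berwald_h G O W U A : Prop :=
  forall z, O z -> gam (A z) = vproj G (bracket (beta G W) (gam \o U)) z.

Definition berwald_v G O W U A : Prop :=
  forall z, O z -> A z = rho (bracket (gam \o W) (beta G U) z).

Definition cartan_v E G O W U A : Prop :=
  forall V : pt -> vec, smooth_on V O -> forall z, O z ->
    2 * gmetric E z (A z) (V z) =
      'd (fun z' => gmetric E z' (U z') (V z')) z (gam (W z))
      + gmetric E z (U z) (rho (bracket (beta G V) (gam \o W) z))
      + gmetric E z (V z) (rho (bracket (gam \o W) (beta G U) z)).

Definition cartan_h E G O W U A : Prop :=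
  forall V : pt -> vec, smooth_on V O -> forall z, O z ->
    2 * gmetric E z (A z) (V z) =
      'd (fun z' => gmetric E z' (U z') (V z')) z (beta G W z)
      + 'd (fun z' => gmetric E z' (V z') (W z')) z (beta G U z)
      - 'd (fun z' => gmetric E z' (W z') (U z')) z (beta G V z)
      - gmetric E z (W z) (rho (bracket (beta G U) (beta G V) z))
      + gmetric E z (U z) (rho (bracket (beta G V) (beta G W) z))
      + gmetric E z (V z) (rho (bracket (beta G W) (beta G U) z)).

Definition concurrent_on E G O phi : Prop :=
  forall W, smooth_on W O ->
    [/\ cartan_h E G O W phi (fun z => - W z),
        berwald_h G O W phi (fun z => - W z),
        cartan_v E G O W phi (fun=> 0) &
        berwald_v G O W phi (fun=> 0)].

End PullbackFormalism.

(** ** Finsler structures *)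

Section Finsler.
Context {R : realType} {n : nat} {M : manifold R n}.
Implicit Types (F H f : tangent M -> R) (D : set (tangent M))
  (phi : tangent M -> tangent M).

Definition energy F (i : atlas M) : 'rV[R]_n * 'rV[R]_n -> R :=
  fun z => F (tvec i z) ^+ 2 / 2.

Definition finsler F : Prop :=
  [/\ forall v, 0 <= F v,
      smooth_fun F slit,
      tcontinuous F,
      forall (c : R) v, 0 < c -> F (tscale c v) = c * F v &
      forall i z, slit_chart i z -> max_rank (ddJ (energy F i) z)].

Definition conic_domain D : Prop :=
  [/\ D `<=` slit /\ D !=set0,
      topen D,
      forall (c : R) v, 0 < c -> D v -> D (tscale c v),
      forall x : M, exists2 v, D v & base v = x &
      forall i u, cimage i u -> connected (fibre D i u)].

Definition conic_pseudo_finsler D H : Prop :=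
  conic_domain D /\
  [/\ forall v, D v -> 0 <= H v,
      smooth_fun H D,
      forall (c : R) v, 0 < c -> D v -> H (tscale c v) = c * H v &
      forall i z, in_chart D i z -> max_rank (ddJ (energy H i) z)].

Definition geodesic_spray F
    (G : atlas M -> 'rV[R]_n * 'rV[R]_n -> 'rV[R]_n * 'rV[R]_n) : Prop :=
  slit_vector_field G /\
  forall i, geodesic_spray_on (energy F i) (G i) (slit_chart i).

Definition concurrent F G phi : Prop :=
  [/\ pi_vector_field phi,
      forall v, slit v -> slit (phi v) &
      forall i,
        concurrent_on (energy F i) (G i) (slit_chart i) (pi_comp phi i)].

(* The metric tensor at [v] is computed in a chart around [base v]; being a
   tensor it does not depend on the chart. *)
Definition chart_at (x : M) : atlas M := projT1 (cid (dom_cover x)).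

Definition metric F (v w1 w2 : tangent M) : R :=
  let i := chart_at (base v) in
  gmetric (energy F i) (coords i v) (comp w1 i) (comp w2 i).

Definition assoc_form F phi (v w : tangent M) : R := metric F v (phi v) w.

(* [y \in T_xM], seen as an element of the fibre over [(x, y)], is eta-bar. *)
Definition Phi_of F phi (v : tangent M) : R := assoc_form F phi v v.

Definition p2_of F phi (v : tangent M) : R := metric F v (phi v) (phi v).

(** ** Rationality in the fibre coordinates *)

Definition rational_on (S : set 'rV[R]_n) (f : 'rV[R]_n -> R) : Prop :=
  exists P Q : mpoly.mpoly n R, forall y, S y ->
    mpoly.meval (fun k => y 0 k) Q != 0 /\
    f y = mpoly.meval (fun k => y 0 k) P / mpoly.meval (fun k => y 0 k) Q.

Definition rational_in_y D f : Prop :=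
  forall i u, cimage i u -> rational_on (fibre D i u) (fun y => f (tvec i (u, y))).

(* [a i z k l] is the component a_kl at the point [z] of the chart [i]. *)
Definition rational_factorization D H (theta : tangent M -> R)
    (a : atlas M -> 'rV[R]_n * 'rV[R]_n -> 'M[R]_n) : Prop :=
  [/\ forall v, D v -> 0 < theta v,
      smooth_fun theta D,
      forall i z, in_chart D i z ->
        [/\ hess (energy H i) z = theta (tvec i z) *: a i z,
            (a i z)^T = a i z & a i z \in unitmx] &
      forall i u k l, cimage i u ->
        rational_on (fibre D i u) (fun y => a i (u, y) k l)].

Definition almost_rational D H : Prop :=
  exists theta a, rational_factorization D H theta a.

Definition rational_metric D H : Prop :=
  exists theta a, rational_factorization D H theta a /\ rational_in_y D theta.

End Finsler.

(* Main.v *)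
From HB Require Import structures.
Require Import Defs.
From mathcomp Require Import all_boot all_order all_algebra.
From mathcomp Require Import all_classical all_reals all_analysis.
From mathcomp Require Import -(notations) mpoly.
From mathcomp Require Import ring lra.

(** In a chart, [g(phi, .)] has components [phi_k] with zero vertical derivative:
    the Cartan condition in the vertical directions, tested against the constant
    fields, loses its bracket terms because the Berwald derivative of [phi]
    vanishes. As the fibres of [D] are connected, [Phi] is on each of them a
    nonzero linear form [l]. By Euler's identity the square of a metric function
    with rational Hessian is rational, so [A = F^2] is. If [F] is rational, so
    are [F^2 / (F - l)] and its Hessian. Conversely, if [B = F^4 / (F - l)^2] is
    rational then so is [2 F l = A + l^2 - A^2 / B]. To recover [F] with a
    denominator which does not vanish where [l] does, differentiate along a
    direction not in the kernel of [l]. *)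

Set Implicit Arguments.
Unset Strict Implicit.
Unset Printing Implicit Defensive.

Import Order.TTheory GRing.Theory Num.Theory.
Import numFieldNormedType.Exports.

Local Open Scope classical_set_scope.
Local Open Scope ring_scope.

(** * Polynomials and rational functions under directional derivatives *)

Section RationalFunctions.
Context {R : realType} {n : nat}.
Implicit Types (S : set 'rV[R]_n) (f g : 'rV[R]_n -> R) (v w y : 'rV[R]_n)
  (P Q : mpoly n R).

Definition peval P y : R := meval (fun k => y 0 k) P.

Definition pderive v P : mpoly n R := \sum_k v 0 k *: mderiv k P.

Lemma pevalM P Q : peval (P * Q) = peval P * peval Q.
Proof. by apply/funext => y; rewrite /peval mevalM. Qed.

Lemma pderiveM v P Q : pderive v (P * Q) = pderive v P * Q + P * pderive v Q.
Proof.
rewrite /pderive mulr_suml mulr_sumr -big_split; apply: eq_bigr => k _ /=.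
by rewrite mderivM scalerDr scalerAl scalerAr.
Qed.

Lemma is_derive_coord v y k : is_derive y v (fun y => y 0 k : R) (v 0 k).
Proof.
have did : derivable (id : 'rV[R]_n -> 'rV[R]_n) y v by exact: derivable_id.
apply: DeriveDef; first by have /derivable_mxP := did; apply.
have := derive_mx did; rewrite derive_id => /matrixP/(_ 0 k).
by rewrite mxE => <-.
Qed.

(** Constants and variables satisfy the claim, and it passes to sums and products, which generate
    all polynomials. *)
Lemma is_derive_peval P v y : is_derive y v (peval P) (peval (pderive v P) y).
Proof.
pose good P := forall y, is_derive y v (peval P) (peval (pderive v P) y).
have goodM P1 P2 : good P1 -> good P2 -> good (P1 * P2).
  move=> g1 g2 z; rewrite pevalM pderiveM /peval mevalD !mevalM -!/(peval _ z).
  apply: is_derive_eq.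
    by apply: is_deriveM; [exact: g1|exact: g2].
  by rewrite [LHS]addrC /GRing.scale/= [X in X + _]mulrC.
have goodC c : good (mpolyC n c).
  move=> z; rewrite (_ : peval _ = cst c); last first.
    by apply/funext => u; rewrite /peval mevalC.
  apply: is_derive_eq; rewrite /pderive big1 ?/peval ?meval0// => k _.
  by rewrite mderivC scaler0.
have goodX k : good (mpolyX R (mnm1 k)).
  move=> z; rewrite (_ : peval _ = fun y => y 0 k); last first.
    by apply/funext => u; rewrite /peval mevalXU.
  apply: is_derive_eq; first exact: is_derive_coord.
  rewrite /pderive /peval (bigD1 k)//= mevalD mevalZ mderivX mnm1E eqxx scale1r.
  rewrite mevalX big1 => [|l _]; last by rewrite mnmBE subnn expr0.
  rewrite mulr1 raddf_sum big1 ?addr0//= => l lk.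
  by rewrite mderivX mnm1E eq_sym (negbTE lk) scale0r scaler0 meval0.
have goodD P1 P2 : good P1 -> good P2 -> good (P1 + P2).
  move=> g1 g2 z; rewrite (_ : peval (P1 + P2) = peval P1 + peval P2); last first.
    by apply/funext => u; rewrite /peval mevalD.
  apply: is_derive_eq; first by apply: is_deriveD; [exact: g1|exact: g2].
  rewrite /pderive /peval -mevalD -big_split; congr meval.
  by apply: eq_bigr => k _; rewrite mderivD scalerDr.
suff : good P by exact.
elim/mpolyind: P => [|c m P _ _ gP]; first by rewrite -(mpolyC0 n R).
apply: (goodD) => //; rewrite -mul_mpolyC; apply: (goodM) => //.
(* A monomial is a product of powers of variables, so [goodM] and [goodX] reach it. *)
rewrite mpolyXE_id; apply: big_ind => //; first by rewrite -(mpolyC1 n R).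
move=> k _; elim: (m k) => [|j IH]; first by rewrite expr0 -(mpolyC1 n R).
by rewrite exprS; apply: (goodM).
Qed.

Lemma derive_peval P v y : 'D_v (peval P) y = peval (pderive v P) y.
Proof. by have d := is_derive_peval P v y; rewrite derive_val. Qed.

Lemma derivable_peval P v y : derivable (peval P) y v.
Proof. by have d := is_derive_peval P v y; exact: ex_derive. Qed.

Lemma pderiveC v w P : pderive v (pderive w P) = pderive w (pderive v P).
Proof.
have dsum k (F : 'I_n -> mpoly n R) :
    mderiv k (\sum_l F l) = \sum_l mderiv k (F l).
  exact: (big_morph _ (mderivD k) (mderiv0 R k)).
rewrite /pderive; under eq_bigr do rewrite dsum scaler_sumr.
under [RHS]eq_bigr do rewrite dsum scaler_sumr.
rewrite exchange_big; apply: eq_bigr => k _; apply: eq_bigr => l _ /=.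
by rewrite !mderivZ !scalerA mulrC mderiv_comm.
Qed.

Lemma rational_ext S f g : {in S, f =1 g} -> rational_on S f -> rational_on S g.
Proof.
move=> fg [P [Q h]]; exists P, Q => y Sy; have [Q0 fE] := h y Sy.
by rewrite -fg ?inE.
Qed.

Lemma rational_sub S T f : S `<=` T -> rational_on T f -> rational_on S f.
Proof. by move=> ST [P [Q h]]; exists P, Q => y /ST/h. Qed.

Lemma rational_peval S P : rational_on S (peval P).
Proof. by exists P, 1 => y _; rewrite meval1 oner_neq0 divr1. Qed.

Lemma rational_cst S (c : R) : rational_on S (fun=> c).
Proof.
by apply: rational_ext (rational_peval S (mpolyC n c)) => y _; rewrite /peval mevalC.
Qed.

Lemma rational_coord S k : rational_on S (fun y => y 0 k).
Proof.
apply: rational_ext (rational_peval S (mpolyX R (mnm1 k))) => y _.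
by rewrite /peval mevalXU.
Qed.

Lemma rationalD S f g : rational_on S f -> rational_on S g ->
  rational_on S (fun y => f y + g y).
Proof.
move=> [P [Q hf]] [P' [Q' hg]]; exists (P * Q' + P' * Q), (Q * Q') => y Sy.
have [Q0 ->] := hf y Sy; have [Q'0 ->] := hg y Sy.
by rewrite !mevalD !mevalM mulf_neq0// addf_div.
Qed.

Lemma rationalM S f g : rational_on S f -> rational_on S g ->
  rational_on S (fun y => f y * g y).
Proof.
move=> [P [Q hf]] [P' [Q' hg]]; exists (P * P'), (Q * Q') => y Sy.
have [Q0 ->] := hf y Sy; have [Q'0 ->] := hg y Sy.
by rewrite !mevalM mulf_neq0// mulf_div.
Qed.

(** [P] and [Q] trade places; [f] having no zero on [S] keeps the new denominator [P] from vanishing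
    there. *)
Lemma rationalV S f : (forall y, S y -> f y != 0) -> rational_on S f ->
  rational_on S (fun y => (f y)^-1).
Proof.
move=> f0 [P [Q hf]]; exists Q, P => y Sy; have [Q0 fE] := hf y Sy.
have := f0 y Sy; rewrite fE invf_div => PQ0; split=> //.
by apply: contraNneq PQ0 => ->; rewrite mul0r.
Qed.

Lemma rationalZ S f (c : R) : rational_on S f -> rational_on S (fun y => c * f y).
Proof. by move=> h; apply: rationalM => //; exact: rational_cst. Qed.

Lemma rationalB S f g : rational_on S f -> rational_on S g ->
  rational_on S (fun y => f y - g y).
Proof.
move=> hf hg; apply: rational_ext (rationalD hf (rationalZ (-1) hg)) => y _.
by rewrite mulN1r.
Qed.

Lemma rationalX S f k : rational_on S f -> rational_on S (fun y => f y ^+ k).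
Proof.
move=> hf; elim: k => [|k IH]; first exact: rational_cst.
by apply: rational_ext (rationalM hf IH) => y _; rewrite exprS.
Qed.

Lemma rational_sum S (I : Type) (r : seq I) (F : I -> 'rV[R]_n -> R) :
  (forall k, rational_on S (F k)) -> rational_on S (fun y => \sum_(k <- r) F k y).
Proof.
move=> hF; elim: r => [|k r IH].
  by apply: rational_ext (rational_cst S 0) => y _; rewrite big_nil.
by apply: rational_ext (rationalD (hF k) IH) => y _; rewrite big_cons.
Qed.

Lemma near_open_eq (V : topologicalType) (W : Type) (S : set V) (f g : V -> W) (x : V) :
  open S -> S x -> {in S, f =1 g} -> \forall z \near x, f z = g z.
Proof.
move=> oS Sx fg; near=> z; apply: fg; rewrite inE.
by near: z; exact: open_nbhs_nbhs.
Unshelve. all: by end_near. Qed.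

Lemma is_derive_quotient v y P Q : peval Q y != 0 ->
  is_derive y v (fun z => peval P z / peval Q z)
   (peval (pderive v P * Q - P * pderive v Q) y / peval (Q * Q) y).
Proof.
move=> Q0; have dP := is_derive_peval P v y; have dQ := is_derive_peval Q v y.
have dV : is_derive y v (fun z => (peval Q z)^-1)
    (- (peval Q y) ^- 2 * peval (pderive v Q) y).
  apply: DeriveDef; first by apply: derivableV => //; exact: ex_derive.
  by rewrite deriveV ?derive_val.
apply: (is_derive_eq (is_deriveM dP dV)).
rewrite /= /peval mevalB !mevalM -!/(peval _ y) /GRing.scale/=.
by field.
Qed.

(** As [S] is open, [f] coincides near each of its points with one fixed quotient [P / Q], so the
    quotient rule applies, with denominator [Q * Q]. *)
Lemma rational_derive S f v : open S -> rational_on S f ->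
  rational_on S ('D_v f) /\ (forall y, S y -> derivable f y v).
Proof.
move=> oS [P [Q h]].
have dS y : S y -> is_derive y v f
   (peval (pderive v P * Q - P * pderive v Q) y / peval (Q * Q) y).
  move=> Sy; have [Q0 _] := h y Sy.
  apply: near_eq_is_derive (is_derive_quotient v P Q0).
  apply: (near_open_eq oS) => // z; rewrite inE => Sz.
  by have [_ ->] := h z Sz.
split=> [|y /dS d]; last exact: ex_derive.
exists (pderive v P * Q - P * pderive v Q), (Q * Q) => y Sy.
have [Q0 _] := h y Sy; have d := dS y Sy.
by rewrite derive_val; split=> //; rewrite mevalM mulf_neq0.
Qed.

(** This will give the symmetry of the Hessian of a rational energy. *)
Lemma rational_deriveC S f v w y : open S -> rational_on S f -> S y ->
  'D_v ('D_w f) y = 'D_w ('D_v f) y.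
Proof.
move=> oS hf Sy; have [P [Q h]] := hf.
(* Differentiating [f Q = P] twice leaves an expression symmetric in [v, w]. *)
have fQ u : S u -> f u * peval Q u = peval P u.
  by move=> Su; have [Q0 ->] := h u Su; rewrite divfK.
have D1 a u : S u ->
    'D_a f u * peval Q u + f u * peval (pderive a Q) u = peval (pderive a P) u.
  move=> Su; have [Q0 _] := h u Su.
  have df := (rational_derive a oS hf).2 u Su.
  have /(near_eq_derive a) : \forall z \near u, (f * peval Q) z = peval P z.
    by apply: (near_open_eq oS) => // z; rewrite inE; exact: fQ.
  rewrite (deriveM df (@derivable_peval Q a u)) !derive_peval /GRing.scale/= => <-.
  by ring.
have D2 a b : 'D_b ('D_a f) y * peval Q y + 'D_a f y * peval (pderive b Q) y
   + ('D_b f y * peval (pderive a Q) y + f y * peval (pderive b (pderive a Q)) y)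
   = peval (pderive b (pderive a P)) y.
  have [hDa df] := rational_derive a oS hf.
  have [_ ddf] := rational_derive b oS hDa.
  have {}ddf := ddf y Sy; have dbf := (rational_derive b oS hf).2 y Sy.
  have dQ := @derivable_peval Q b y; have dQ' := @derivable_peval (pderive a Q) b y.
  have /(near_eq_derive b) : \forall z \near y,
      ('D_a f * peval Q + f * peval (pderive a Q)) z = peval (pderive a P) z.
    by apply: (near_open_eq oS) => // z; rewrite inE; exact: D1.
  rewrite (deriveD (derivableM ddf dQ) (derivableM dbf dQ')).
  rewrite (deriveM ddf dQ) (deriveM dbf dQ') !derive_peval /GRing.scale/= => <-.
  by ring.
have [Q0 _] := h y Sy; apply: (mulIf Q0).
(* Apart from the mixed derivatives, the two instances of [D2] differ only by an exchange of the
   products of first derivatives. *)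
have cancel4 (a a' b c d : R) : a + b + (c + d) = a' + c + (b + d) -> a = a'.
  by rewrite addrACA => /addIr/addIr.
have := D2 v w; rewrite ![pderive w (pderive v _)]pderiveC -D2.
by move/esym/cancel4.
Qed.

End RationalFunctions.

(** * Functions with zero derivative on connected open sets *)

Lemma derive_line (R : realType) (V : normedModType R) (f : V -> R) (x v : V) (t : R) :
  derivable f (t *: v + x) v ->
  is_derive t 1 (fun s => f (s *: v + x)) ('D_v f (t *: v + x)).
Proof.
have e : (fun h : R => h^-1 *: (((fun s => f (s *: v + x)) \o shift t) (h *: 1)
     - f (t *: v + x))) =
   (fun h : R => h^-1 *: ((f \o shift (t *: v + x)) (h *: v) - f (t *: v + x))).
  by apply/funext => h /=; rewrite [h *: 1]mulr1 scalerDl addrA.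
by move=> df; apply: DeriveDef; rewrite /derivable /derive e.
Qed.

(** The mean value theorem on segments inside a ball makes [f] locally constant; a level set is then
    both open and closed in [S]. *)
Lemma derive_eq0_connected (R : realType) (V : normedModType R) (f : V -> R)
    (S : set V) : open S -> connected S ->
  (forall y v, S y -> is_derive y v f 0) ->
  forall x y, S x -> S y -> f x = f y.
Proof.
move=> oS cS df x y Sx Sy.
have loc z : S z -> \forall w \near z, f w = f z.
  move=> Sz; have /nbhs_ballP[r /= r0 rS] : nbhs z S by exact: open_nbhs_nbhs.
  apply/nbhs_ballP; exists r => //= w zw.
  pose g (t : R) := f (t *: (w - z) + z).
  have dg (t : R) : t \in `[0, 1] -> is_derive t 1 g 0.
    rewrite in_itv/= => /andP[t0 t1].
    have St : S (t *: (w - z) + z).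
      apply: rS; rewrite -ball_normE/= opprD addrCA subrr addr0 normrN normrZ.
      rewrite ger0_norm//; move: zw; rewrite -ball_normE/= distrC => zw.
      by rewrite (le_lt_trans _ zw)// ler_piMl.
    have d := df _ (w - z) St.
    by apply: is_derive_eq; [apply: derive_line; exact: ex_derive|rewrite derive_val].
  have cg : {within `[0, 1], continuous g}.
    by apply: derivable_within_continuous => t /dg d; exact: ex_derive.
  have dg' (t : R) : t \in `]0, 1[ -> is_derive t 1 g 0.
    by move=> /subset_itv_oo_cc; exact: dg.
  have [c _] := MVT_segment ler01 dg' cg.
  by rewrite mul0r /g scale1r scale0r add0r subrK => /eqP; rewrite subr_eq0 => /eqP.
have oeq (P : R -> Prop) : open [set z | S z /\ P (f z)].
  rewrite openE => z [Sz Pz]; near=> w; split.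
    by near: w; exact: open_nbhs_nbhs.
  by rewrite (_ : f w = f z)//; near: w; exact: loc.
have : [set z | S z /\ f z = f x] = S.
  apply: cS; first by exists x.
    exists [set z | S z /\ f z = f x]; first exact: (oeq (eq^~ (f x))).
    by rewrite predeqE => z/=; tauto.
  exists (~` [set z | S z /\ f z <> f x]).
    by apply: open_closedC; exact: (oeq (fun r => r <> f x)).
  rewrite predeqE => z/=; split=> [[Sz fz]|[Sz h]]; first by split=> // -[].
  by split=> //; apply: contrapT => fz; apply: h.
by move=> /predeqP /(_ y) [_ /(_ Sy) []].
Unshelve. all: by end_near. Qed.

(** * Differentiability as a local property *)

Lemma near0_differentiable (R : realType) (V W : normedModType R) (h : V -> W) x :
  (\forall z \near x, h z = 0) -> differentiable h x.
Proof.
move=> h0; apply/diffP.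
(* The differential is a chosen linear map, so the expansion only has to be shown for some
   continuous linear map, here zero. *)
apply: (@getPex _ (fun (df : {linear V -> W}) => continuous df /\
  forall y, h y = h (lim (nbhs x)) + df (y - lim (nbhs x))
                  +o_(y \near x) (y - lim (nbhs x)))).
exists (\0 : {linear V -> W}); split; first exact: cst_continuous.
rewrite lim_id//.
have E : h = (fun y => h x + (\0 : {linear V -> W}) (y - x)) +o_x (center x).
  apply/eqaddoP => e e0; near=> y.
  rewrite /= (nbhs_singleton h0) !fctE/= (_ : h y = 0) ?addr0 ?subr0 ?normr0.
    by rewrite mulr_ge0// ltW.
  by near: y.
by move=> y; rewrite {1}E.
Unshelve. all: by end_near. Qed.

Lemma near_eq_differentiable (R : realType) (V W : normedModType R) (f g : V -> W) x :
  (\forall z \near x, f z = g z) -> differentiable f x -> differentiable g x.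
Proof.
move=> fg df; rewrite (_ : g = f + (g - f)); last by rewrite addrC subrK.
apply: (differentiableD df); apply: near0_differentiable.
near=> z; have fgz : f z = g z by near: z.
by rewrite -[LHS]/(g z - f z) fgz subrr.
Unshelve. all: by end_near. Qed.

(** * Vertical directions in natural coordinates *)

Section Fibre.
Context {R : realType} {n : nat}.
Local Notation vec := 'rV[R]_n.
Local Notation pt := ('rV[R]_n * 'rV[R]_n)%type.
Implicit Types (E : pt -> R) (f : vec -> R) (S : set vec) (u v w y : vec).

Local Notation e_ k := (delta_mx 0 k : 'rV[R]_n).

Lemma gam_growth_rate E u y v :
  (fun h : R => h^-1 *: ((E \o shift (u, y)) (h *: gam v) - E (u, y))) =
  (fun h : R => h^-1 *: (((fun y' => E (u, y')) \o shift y) (h *: v) - E (u, y))).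
Proof.
apply/funext => h; rewrite /comp /shift; congr (_ *: (E _ - _)).
by rewrite [LHS]surjective_pairing/= scaler0 add0r.
Qed.

Lemma derive_gam E u y v : 'D_(gam v) E (u, y) = 'D_v (fun y' => E (u, y')) y.
Proof. by rewrite /derive gam_growth_rate. Qed.

Lemma derivable_gam E u y v :
  derivable E (u, y) (gam v) = derivable (fun y' => E (u, y')) y v.
Proof. by rewrite /derivable gam_growth_rate. Qed.

Lemma gam_sum v : gam v = \sum_k v 0 k *: gam (e_ k).
Proof.
have gamD : {morph gam : a b / a + b :> vec >-> a + b :> pt}.
  by move=> a b; rewrite [RHS]surjective_pairing/= addr0.
rewrite {1}[v]row_sum_delta (big_morph gam gamD (erefl _)).
apply: eq_bigr => k _; rewrite /gam [RHS]surjective_pairing/=.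
by rewrite scaler0.
Qed.

End Fibre.

(** * Stability of the classes C^k *)

Section Smooth.
Context {R : realType} {V : normedModType R}.
Implicit Types (f g : V -> R) (U : set V) (x v : V) (k : nat).

(** The induction goes through because differentials are directional derivatives, which only see
    germs, and [U] is open. *)
Lemma Ck_ext k f g U : open U -> {in U, f =1 g} -> Ck_on k f U -> Ck_on k g U.
Proof.
move=> oU; elim: k f g => [|k IH] f g fg /=.
  move=> cf x Ux; have fgx := near_open_eq oU Ux fg.
  have fgxE : f x = g x by apply: fg; rewrite inE.
  suff : g @ x --> g x by [].
  rewrite -fgxE; apply: cvg_trans (cf x Ux).
  exact: near_eq_cvg.
move=> [df Cf]; split=> [x Ux|v].
  exact: near_eq_differentiable (near_open_eq oU Ux fg) (df x Ux).
apply: (IH (fun x => 'd f x v) (fun x => 'd g x v)); last exact: Cf.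
move=> x; rewrite inE => Ux.
have dg := near_eq_differentiable (near_open_eq oU Ux fg) (df x Ux).
by rewrite -!deriveE//; [exact: near_eq_derive (near_open_eq oU Ux fg)|exact: df].
Qed.

Lemma Ck_weaken k f U : Ck_on k.+1 f U -> Ck_on k f U.
Proof.
elim: k f => [|k IH] f [df Cf]; first by move=> x /df/differentiable_continuous.
by split=> // v; exact: IH.
Qed.

Lemma smooth_differentiable f U x : smooth_on f U -> U x -> differentiable f x.
Proof. by move=> /(_ 1%N)[df _]; exact: df. Qed.

Lemma smooth_diff f U v : smooth_on f U -> smooth_on (fun x => 'd f x v) U.
Proof. by move=> sf k; have [_] := sf k.+1; exact. Qed.

Lemma Ck_cst (W : normedModType R) k (c : W) U : Ck_on k (cst c : V -> W) U.
Proof.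
elim: k c => [|k IH] c; first by move=> x _; exact: cst_continuous.
split=> [x _|v]; first exact: differentiable_cst.
rewrite (_ : (fun x => _) = cst 0); first exact: IH.
by apply/funext => x; rewrite diff_cst.
Qed.

Lemma smooth_cst (W : normedModType R) (c : W) U : smooth_on (cst c : V -> W) U.
Proof. by move=> k; exact: Ck_cst. Qed.

Lemma CkD k f g U : open U -> Ck_on k f U -> Ck_on k g U -> Ck_on k (f + g) U.
Proof.
move=> oU; elim: k f g => [|k IH] f g.
  by move=> cf cg x Ux; exact: cvgD (cf x Ux) (cg x Ux).
move=> [df Cf] [dg Cg]; split=> [x Ux|v].
  exact: differentiableD (df x Ux) (dg x Ux).
apply: (@Ck_ext k ((fun x => 'd f x v) + (fun x => 'd g x v))) => //.
  2: exact: (IH _ _ (Cf v) (Cg v)).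
by move=> x; rewrite inE => Ux; rewrite (diffD (df x Ux) (dg x Ux)).
Qed.

(** Leibniz's rule multiplies derivatives by [f] and [g] themselves, whose class is lowered by
    [Ck_weaken] to match the induction hypothesis. *)
Lemma CkM k f g U : open U -> Ck_on k f U -> Ck_on k g U -> Ck_on k (f * g) U.
Proof.
move=> oU; elim: k f g => [|k IH] f g.
  by move=> cf cg x Ux; exact: cvgM (cf x Ux) (cg x Ux).
move=> Cf Cg; have [[df Cdf] [dg Cdg]] := (Cf, Cg); split=> [x Ux|v].
  exact: differentiableM (df x Ux) (dg x Ux).
apply: (@Ck_ext k (f * (fun x => 'd g x v) + g * (fun x => 'd f x v))) => //.
  by move=> x; rewrite inE => Ux; rewrite (diffM (df x Ux) (dg x Ux)).
exact: (CkD oU (IH _ _ (Ck_weaken Cf) (Cdg v)) (IH _ _ (Ck_weaken Cg) (Cdf v))).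
Qed.

Lemma smoothM f g U : open U -> smooth_on f U -> smooth_on g U -> smooth_on (f * g) U.
Proof. by move=> oU sf sg k; exact: (CkM oU (sf k) (sg k)). Qed.

Lemma smooth_half_sqr f U : open U -> smooth_on f U ->
  smooth_on (fun x => f x ^+ 2 / 2) U.
Proof.
move=> oU sf; rewrite (_ : (fun x => _) = f * f * cst 2^-1); last first.
  by apply/funext => x; rewrite expr2.
by apply: (smoothM oU (smoothM oU sf sf)); exact: smooth_cst.
Qed.

End Smooth.

(** * Vertical Hessians, the metric and Euler's identities *)

Section FibreCalculus.
Context {R : realType} {n : nat}.
Local Notation vec := 'rV[R]_n.
Local Notation pt := ('rV[R]_n * 'rV[R]_n)%type.
Local Notation e_ k := (delta_mx 0 k : 'rV[R]_n).
Implicit Types (E : pt -> R) (O : set pt) (f : vec -> R) (S : set vec)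
  (u v w y : vec) (z a b : pt).

(** Phrased with ['D] instead of the differential, so that it can be read off the total space
    through [derive_gam]; linearity in the direction lets Euler's identities pass to coordinates. *)
Definition fibre_C1 f S := forall y, S y ->
  (forall v, derivable f y v) /\
  (forall v, 'D_v f y = \sum_k v 0 k * 'D_(e_ k) f y).

Definition fhess f y : 'M[R]_n := \matrix_(k, l) 'D_(e_ k) ('D_(e_ l) f) y.

Lemma fibre_C1_ext f g S : open S -> {in S, f =1 g} -> fibre_C1 f S -> fibre_C1 g S.
Proof.
move=> oS fg C1 y Sy; have [df lf] := C1 y Sy.
have fgy := near_open_eq oS Sy fg; split=> [v|v].
  exact: near_eq_derivable fgy (df v).
rewrite -(near_eq_derive v fgy) lf; apply: eq_bigr => k _.
by rewrite (near_eq_derive _ fgy).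
Qed.

Lemma open_fibre O u : open O -> open [set y | O (u, y)].
Proof.
have cu : continuous (fun y : vec => (u, y) : pt).
  move=> y; apply: differentiable_continuous.
  by apply: differentiable_pair; first exact: differentiable_cst.
by move=> oO; apply: (@open_comp _ _ (fun y : vec => (u, y) : pt) O) => // y _.
Qed.

Lemma diff_gam_sum E z v : 'd E z (gam v) = \sum_k v 0 k * 'd E z (gam (e_ k)).
Proof. by rewrite gam_sum linear_sum; apply: eq_bigr => k _; rewrite linearZ. Qed.

Lemma smooth_fibre_derive E O u y v : smooth_on E O -> O (u, y) ->
  'D_v (fun y' => E (u, y')) y = 'd E (u, y) (gam v).
Proof.
by move=> sE Oz; rewrite -derive_gam deriveE//; exact: smooth_differentiable sE Oz.
Qed.

Lemma smooth_fibre_C1 E O u : smooth_on E O ->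
  fibre_C1 (fun y => E (u, y)) [set y | O (u, y)].
Proof.
move=> sE y Oz; have dE := smooth_differentiable sE Oz; split=> v.
  by rewrite -derivable_gam; exact: diff_derivable.
rewrite (smooth_fibre_derive v sE Oz) diff_gam_sum; apply: eq_bigr => k _.
by rewrite (smooth_fibre_derive _ sE Oz).
Qed.

Lemma smooth_fibre_deriveE E O u w : open O -> smooth_on E O ->
  {in [set y | O (u, y)],
    (fun y => 'd E (u, y) (gam w)) =1 'D_w (fun y' => E (u, y'))}.
Proof. by move=> oO sE y; rewrite inE => Oz; rewrite (smooth_fibre_derive w sE Oz). Qed.

Lemma smooth_fibre_C1_derive E O u w : open O -> smooth_on E O ->
  fibre_C1 ('D_w (fun y => E (u, y))) [set y | O (u, y)].
Proof.
move=> oO sE; apply: fibre_C1_ext (smooth_fibre_deriveE w oO sE) _.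
  exact: open_fibre.
exact: smooth_fibre_C1 (smooth_diff (gam w) sE).
Qed.

Lemma smooth_fibre_derive2 E O u y v w : open O -> smooth_on E O -> O (u, y) ->
  'd (fun z => 'd E z (gam w)) (u, y) (gam v) = 'D_v ('D_w (fun y' => E (u, y'))) y.
Proof.
move=> oO sE Oz; rewrite -(smooth_fibre_derive v (smooth_diff (gam w) sE) Oz).
by apply: near_eq_derive; apply: near_open_eq (smooth_fibre_deriveE w oO sE);
  [exact: open_fibre|].
Qed.

Lemma hess_fhess E O u y : open O -> smooth_on E O -> O (u, y) ->
  hess E (u, y) = fhess (fun y' => E (u, y')) y.
Proof.
move=> oO sE Oz; apply/matrixP => k l.
by rewrite !mxE (smooth_fibre_derive2 _ _ oO sE Oz).
Qed.

Lemma diff_cstE (V W : normedModType R) (c : W) (x v : V) :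
  'd (fun=> c : W) x v = 0.
Proof. by rewrite [X in X v](diff_cst c x). Qed.

Lemma Jvert_vert v : Jvert (gam v) = 0.
Proof. by []. Qed.

(** [Jvert] kills vertical vectors, so only one of the two terms of [ext_d] survives. This makes the
    metric the vertical Hessian of the energy. *)
Lemma ddJ_vert E z v b :
  ddJ E z (gam v) b = 'd (fun z' => 'd E z' (gam b.1)) z (gam v).
Proof.
rewrite /ddJ /ext_d.
have -> : d_J E ^~ (gam v) = fun=> 0.
  by apply/funext => z'; rewrite /d_J Jvert_vert linear0.
have -> : d_J E ^~ b = fun z' => 'd E z' (gam b.1) by [].
rewrite [X in _ - X](_ : _ = 0) ?subr0//.
exact: (diff_cstE (0 : R) z b).
Qed.

Lemma gmetricE E z v w : gmetric E z v w = 'd (fun z' => 'd E z' (gam w)) z (gam v).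
Proof. by rewrite /gmetric ddJ_vert. Qed.

Lemma gmetric0l E z w : gmetric E z 0 w = 0.
Proof. by rewrite gmetricE (linear0 ('d (fun z' => 'd E z' (gam w)) z)). Qed.

Lemma gmetric0r E z v : gmetric E z v 0 = 0.
Proof.
rewrite gmetricE; have -> : (fun z' => 'd E z' (gam 0)) = fun=> 0.
  by apply/funext => z'; rewrite linear0.
exact: (diff_cstE (0 : R) z (gam v)).
Qed.

Lemma gmetric_suml E z v w : gmetric E z v w = \sum_k v 0 k * gmetric E z (e_ k) w.
Proof. by rewrite gmetricE diff_gam_sum; apply: eq_bigr => k _; rewrite gmetricE. Qed.

(** Unlike the left argument, [w] sits inside the function being differentiated, so linearity rests
    on the differentiability of the vertical derivatives of [E]. *)
Lemma gmetric_sumr E O u y v w : open O -> smooth_on E O -> O (u, y) ->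
  gmetric E (u, y) v w = \sum_l w 0 l * gmetric E (u, y) v (e_ l).
Proof.
move=> oO sE Oz; rewrite gmetricE.
pose g l z' := w 0 l *: 'd E z' (gam (e_ l)).
have -> : (fun z' => 'd E z' (gam w)) = \sum_l g l.
  by apply/funext => z'; rewrite fct_sumE diff_gam_sum.
have d l : differentiable (fun z' => 'd E z' (gam (e_ l))) (u, y).
  exact: smooth_differentiable (smooth_diff _ sE) Oz.
have dd l : is_derive (u, y) (gam v) (g l) (w 0 l * gmetric E (u, y) v (e_ l)).
  rewrite gmetricE -(deriveE _ (d l)).
  exact: is_deriveZ (derivableP (@diff_derivable _ _ _ _ _ (gam v) (d l))).
have D := is_derive_sum dd.
have dS : differentiable (\sum_l g l) (u, y).
  by apply: differentiable_sum => l; exact: differentiableZ (d l).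
by rewrite -(deriveE (gam v) dS) derive_val.
Qed.

Lemma gmetric_fhess E O u y v w : open O -> smooth_on E O -> O (u, y) ->
  gmetric E (u, y) v w = (v *m fhess (fun y' => E (u, y')) y *m w^T) 0 0.
Proof.
move=> oO sE Oz; rewrite (gmetric_sumr v w oO sE Oz) mxE; apply: eq_bigr => l _.
rewrite mulrC gmetric_suml !mxE; congr (_ * _); apply: eq_bigr => k _.
by rewrite mxE gmetricE (smooth_fibre_derive2 _ _ oO sE Oz).
Qed.

(** Against a vertical vector, [ddJ] only sees the first component of its other argument, so a left
    null vector [v] of the Hessian puts [gam v] in the kernel of the 2-form. *)
Lemma max_rank_fhess E O u y : open O -> smooth_on E O -> O (u, y) ->
  max_rank (ddJ E (u, y)) -> fhess (fun y' => E (u, y')) y \in unitmx.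
Proof.
move=> oO sE Oz mr; set H := fhess _ y.
have H0 v : v *m H = 0 -> v = 0.
  move=> vH; suff : gam v = 0 by case.
  apply: mr => b; rewrite ddJ_vert -gmetricE (gmetric_fhess _ _ oO sE Oz).
  by rewrite -/H vH mul0mx mxE.
rewrite -row_free_unit -kermx_eq0; apply/eqP/row_matrixP => k.
by rewrite row0; apply: H0; rewrite -row_mul mulmx_ker row0.
Qed.

(** Along [y] itself, homogeneity gives the difference quotient exactly: it is
    [((1 + h) ^+ 2 - 1) / h * f y], that is [(2 + h) * f y]. *)
Lemma euler f y : (forall t, 0 < t -> f (t *: y) = t ^+ 2 * f y) ->
  'D_y f y = 2 * f y.
Proof.
move=> hf; apply/cvg_lim => //.
have : (fun h : R => (2 + h) * f y) @ 0^' --> (2 + 0) * f y.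
  have c0 : (fun h : R => 2 + h) @ 0^' --> (2 + 0 : R).
    apply: cvgD; first exact: cvg_cst.
    exact: nbhs_dnbhs.
  exact: cvgM c0 (@cvg_cst _ _ _ _ _).
rewrite addr0.
apply: cvg_trans; apply: near_eq_cvg; near=> h.
have h0 : h != 0 by near: h; exact: nbhs_dnbhs_neq.
(* Homogeneity is only assumed for positive factors. *)
have h1 : 0 < 1 + h.
  have : `|h| < 1 by near: h; exact: dnbhs0_lt.
  by rewrite ltr_norml => /andP[]; lra.
rewrite /= (_ : h *: y + y = (1 + h) *: y); last by rewrite scalerDl scale1r addrC.
rewrite hf// /GRing.scale/=; by field.
Unshelve. all: by end_near. Qed.

(** The second-order identity is the derivative along [e_ k] of the first-order one; the product
    rule produces a term ['D_(e_ k) f] which cancels one of the two on the right. *)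
Lemma euler_hess f S : open S -> fibre_C1 f S -> (forall w, fibre_C1 ('D_w f) S) ->
  (forall t y, 0 < t -> S y -> f (t *: y) = t ^+ 2 * f y) ->
  forall y, S y ->
  (forall k, \sum_l y 0 l * fhess f y k l = 'D_(e_ k) f y) /\
  \sum_k y 0 k * 'D_(e_ k) f y = 2 * f y.
Proof.
move=> oS C1 C2 hf.
have E1 y : S y -> \sum_k y 0 k * 'D_(e_ k) f y = 2 * f y.
  by move=> Sy; rewrite -(C1 y Sy).2; apply: euler => // t t0; exact: hf.
move=> y Sy; split; last exact: E1.
move=> k.
have dl l : is_derive y (e_ k) (fun y => y 0 l * 'D_(e_ l) f y)
    (y 0 l * fhess f y k l + 'D_(e_ l) f y * (e_ k) 0 l).
  have -> : fhess f y k l = 'D_(e_ k) ('D_(e_ l) f) y by rewrite mxE.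
  exact: is_deriveM (is_derive_coord (e_ k) y l)
    (derivableP ((C2 (e_ l) y Sy).1 (e_ k))).
have D := is_derive_sum dl.
have D2 : is_derive y (e_ k) (fun y => 2 * f y) (2 * 'D_(e_ k) f y).
  exact: (is_deriveZ 2 (derivableP ((C1 y Sy).1 (e_ k)))).
have : \sum_l (y 0 l * fhess f y k l + 'D_(e_ l) f y * (e_ k) 0 l) = 2 * 'D_(e_ k) f y.
  rewrite -(@derive_val _ _ _ _ _ _ _ D) -(@derive_val _ _ _ _ _ _ _ D2).
  apply: near_eq_derive; apply: (near_open_eq oS Sy) => z; rewrite inE => Sz.
  by rewrite fct_sumE E1.
rewrite big_split/= [X in _ + X](bigD1 k)//= mxE !eqxx mulr1 [X in _ + (_ + X)]big1.
  by rewrite addr0 mulr_natl mulr2n => /addIr.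
by move=> l lk; rewrite mxE eqxx (negbTE lk) mulr0.
Qed.

End FibreCalculus.

(** * Vertical constancy of the covector of a concurrent field *)

Section Concurrent.
Context {R : realType} {n : nat}.
Local Notation vec := 'rV[R]_n.
Local Notation pt := ('rV[R]_n * 'rV[R]_n)%type.
Local Notation e_ k := (delta_mx 0 k : 'rV[R]_n).
Implicit Types (E : pt -> R) (O : set pt) (G X : pt -> pt) (u v w y : vec) (z a : pt).

Lemma fst_linear_continuous : continuous (fst : {linear pt -> vec}).
Proof. by move=> z; exact: cvg_fst. Qed.

Lemma differentiable_fst X z : differentiable X z -> differentiable (fun z => (X z).1) z.
Proof.
move=> dX; apply: (differentiable_comp dX).
exact: linear_differentiable fst_linear_continuous.
Qed.

Lemma diff_fst X z a : differentiable X z ->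
  'd (fun z => (X z).1) z a = ('d X z a).1.
Proof.
move=> dX; have dfst : differentiable (fst : {linear pt -> vec}) (X z).
  exact: linear_differentiable fst_linear_continuous.
have -> : (fun z => (X z).1) = (fst : {linear pt -> vec}) \o X by [].
by rewrite (diff_comp dX dfst) /= (diff_lin _ fst_linear_continuous).
Qed.

Lemma bracket_cstl a X z : bracket (fun=> a) X z = 'd X z a.
Proof.
rewrite /bracket [X in _ - X](_ : _ = 0) ?subr0//.
exact: (diff_cstE a z (X z)).
Qed.

Lemma bracket_cstr X a z : bracket X (fun=> a) z = - 'd X z a.
Proof.
rewrite /bracket [X in X - _](_ : _ = 0) ?sub0r//.
exact: (diff_cstE a z (X z)).
Qed.

Lemma beta_cstE G v z : beta G (fun=> v) z =
  2^-1 *: ((v, 0) + ('d G z (gam v) - Jvert ('d G z (v, 0)))).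
Proof.
rewrite /beta /hproj /barthel bracket_cstl.
have -> : Jvert \o (fun=> (v, 0)) = (fun=> gam v) by [].
by rewrite bracket_cstl.
Qed.

Lemma diff_snd z a : 'd (fun z : pt => z.2 : vec) z a = a.2.
Proof.
have c : continuous (snd : {linear pt -> vec}) by move=> z'; exact: cvg_snd.
exact: (congr1 (@^~ a) (diff_lin z c)).
Qed.

Lemma differentiable_Jvert X z : differentiable X z ->
  differentiable (fun z => Jvert (X z)) z.
Proof.
move=> dX; apply: (@differentiable_pair _ _ _ _ (fun=> 0) (fun z => (X z).1)).
  exact: differentiable_cst.
exact: differentiable_fst.
Qed.

(** The horizontal component of [beta] of a constant [v] is [v] itself: the lift [(v, 0)]
    contributes one half, and the vertical derivative of [(G z).1 = z.2] the other. A constant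
    component has zero derivative along [gam w]. *)
Lemma beta_const_bracket G O v w z : open O -> smooth_on G O ->
  (forall z, O z -> (G z).1 = z.2) -> O z ->
  rho (bracket (beta G (fun=> v)) (gam \o (fun=> w)) z) = 0.
Proof.
move=> oO sG G1 Oz.
have dG z' : O z' -> differentiable G z' by have [+ _] := sG 1%N; exact.
have dGa a z' : O z' -> differentiable (fun z => 'd G z a) z'.
  by have [_ /(_ a) [+ _]] := sG 2%N; exact.
have X1 : {in O, (fun=> v) =1 (fun z => (beta G (fun=> v) z).1)}.
  move=> z'; rewrite inE => Oz'; rewrite beta_cstE /=.
  have -> : ('d G z' (gam v)).1 = v.
    rewrite -(diff_fst _ (dG _ Oz')) -(deriveE _ (differentiable_fst (dG _ Oz'))).
    rewrite -(@near_eq_derive _ _ _ (fun z => z.2)); last first.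
      by apply: (near_open_eq oO Oz') => z1; rewrite inE => /G1.
    have c : continuous (snd : {linear pt -> vec}) by move=> z1; exact: cvg_snd.
    by rewrite (deriveE _ (linear_differentiable z' c)) diff_snd.
  rewrite subr0 -[v in v + _]scale1r -[X in _ + X]scale1r -scalerDl scalerA.
  by rewrite mulVf ?scale1r// pnatr_eq0.
have dX : differentiable (beta G (fun=> v)) z.
  have -> : beta G (fun=> v) = 2^-1 \*: (cst (v, 0) +
      ((fun z => 'd G z (gam v)) - (fun z => Jvert ('d G z (v, 0))))).
    by apply/funext => z'; rewrite beta_cstE.
  apply: differentiableZ; apply: differentiableD; first exact: differentiable_cst.
  exact: differentiableB (dGa _ _ Oz) (differentiable_Jvert (dGa _ _ Oz)).
have -> : gam \o (fun=> w) = (fun=> gam w) by [].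
rewrite bracket_cstr /rho /= -(diff_fst _ dX) -(deriveE _ (differentiable_fst dX)).
by rewrite -(near_eq_derive _ (near_open_eq oO Oz X1)) derive_cst oppr0.
Qed.

Lemma concurrent_covector_vertical E G O (phi : pt -> vec) v w z :
  open O -> smooth_on E O -> smooth_on G O ->
  (forall z, O z -> Jvert (G z) = liouville z) ->
  concurrent_on E G O phi -> O z ->
  'd (fun z' => gmetric E z' (phi z') v) z (gam w) = 0.
Proof.
move=> oO sE sG JG cphi Oz.
have sw : smooth_on (fun=> w : vec) O by exact: smooth_cst.
have sv : smooth_on (fun=> v : vec) O by exact: smooth_cst.
have [_ _ /(_ _ sv z Oz) cv /(_ z Oz) bv] := cphi _ sw.
(* The zero Cartan derivative empties the left side; by [bv] the bracket paired with [v] is the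
   Berwald derivative, also zero; the other bracket is left to [beta_const_bracket]. *)
move: cv; rewrite gmetric0l mulr0 -bv gmetric0r addr0.
rewrite (beta_const_bracket v w oO sG) ?gmetric0r ?addr0//.
by move=> z' Oz'; have := JG z' Oz' => /(congr1 snd).
Qed.

(** Expanding over basis vectors separates the components of [phi] from the metric coefficients,
    which are second vertical derivatives of [E]. *)
Lemma differentiable_covector E O (phi : pt -> vec) v z :
  open O -> smooth_on E O -> smooth_on phi O -> O z ->
  differentiable (fun z' => gmetric E z' (phi z') v) z.
Proof.
move=> oO sE sphi Oz.
pose g l z' := phi z' 0 l * gmetric E z' (e_ l) v.
have -> : (fun z' => gmetric E z' (phi z') v) = \sum_l g l.
  by apply/funext => z'; rewrite fct_sumE gmetric_suml.
apply: differentiable_sum => l.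
have d1 : differentiable (fun z' => phi z' 0 l : R) z.
  have dphi : differentiable phi z by have [+ _] := sphi 1%N; exact.
  exact: (differentiable_comp dphi (differentiable_coord _ _ _)).
have d2 : differentiable (fun z' => gmetric E z' (e_ l) v) z.
  have -> : (fun z' => gmetric E z' (e_ l) v) =
      fun z' => 'd (fun z' => 'd E z' (gam v)) z' (gam (e_ l)).
    by apply/funext => z'; rewrite gmetricE.
  exact: smooth_differentiable (smooth_diff _ (smooth_diff _ sE)) Oz.
exact: differentiableM d1 d2.
Qed.

Lemma concurrent_covector_const E G O (phi : pt -> vec) u (S : set vec) v y y' :
  open O -> smooth_on E O -> smooth_on G O -> smooth_on phi O ->
  (forall z, O z -> Jvert (G z) = liouville z) -> concurrent_on E G O phi ->
  open S -> connected S -> (forall y, S y -> O (u, y)) -> S y -> S y' ->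
  gmetric E (u, y) (phi (u, y)) v = gmetric E (u, y') (phi (u, y')) v.
Proof.
move=> oO sE sG sphi JG cphi oS cS SO.
apply: (derive_eq0_connected (f := fun y => gmetric E (u, y) (phi (u, y)) v) oS cS).
move=> z w /SO Oz.
have d := differentiable_covector v oO sE sphi Oz.
apply: DeriveDef.
  by have := @diff_derivable _ _ _ _ _ (gam w) d; rewrite derivable_gam.
rewrite -(derive_gam (fun z => gmetric E z (phi z) v)) (deriveE _ d).
exact: (concurrent_covector_vertical v w oO sE sG JG cphi Oz).
Qed.

End Concurrent.

(** * Recovering a function from two rational squares *)

Section Core.
Context {R : realType} {n : nat}.
Local Notation vec := 'rV[R]_n.
Implicit Types (S : set vec) (f g : vec -> R).

Lemma rational_linear S (r : vec) : rational_on S (fun y => \sum_k y 0 k * r 0 k).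
Proof.
apply: rational_sum => k; apply: rationalM; first exact: rational_coord.
exact: rational_cst.
Qed.

Lemma is_derive_linear (r y v : vec) :
  is_derive y v (fun y => \sum_k y 0 k * r 0 k) (\sum_k v 0 k * r 0 k).
Proof.
have dk k : is_derive y v (fun y => y 0 k * r 0 k) (v 0 k * r 0 k).
  have := is_deriveZ (r 0 k) (is_derive_coord v y k).
  rewrite /GRing.scale/= mulrC.
  rewrite (_ : _ \*: _ = fun y : vec => y 0 k * r 0 k)//.
  by apply/funext => z; rewrite mulrC.
have := is_derive_sum dk.
rewrite (_ : \sum_k _ = fun y : vec => \sum_k y 0 k * r 0 k)//.
by apply/funext => z; rewrite fct_sumE.
Qed.

(* [f l] is rational, and so are its derivative [L] along a direction [e] with
   [l e <> 0] and [f L]; the denominator [l^2 + L^2] has no zero because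
   [L = f * l e] where [l = 0]. *)
Lemma rational_of_matsumoto S f (r : vec) :
  open S -> (forall y v, S y -> derivable f y v) -> r != 0 ->
  (forall y, S y -> f y != 0) ->
  (forall y, S y -> f y - \sum_k y 0 k * r 0 k != 0) ->
  rational_on S (fun y => f y ^+ 2) ->
  rational_on S (fun y => (f y ^+ 2 / (f y - \sum_k y 0 k * r 0 k)) ^+ 2) ->
  rational_on S f.
Proof.
move=> oS df r0 f0 fl ratA ratM.
pose l (y : vec) := \sum_k y 0 k * r 0 k.
have ratl : rational_on S l by exact: rational_linear.
have [m rm] : exists m, r 0 m != 0.
  apply/existsP; apply: contraNT r0; rewrite negb_exists => /forallP h.
  apply/eqP/rowP => k; rewrite mxE; apply/eqP; have := h k.
  by rewrite negbK.
pose e : vec := delta_mx 0 m.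
have le : \sum_k e 0 k * r 0 k = r 0 m.
  rewrite (bigD1 m)//= mxE !eqxx mul1r big1 ?addr0// => k km.
  by rewrite mxE eqxx (negbTE km) mul0r.
pose N := f * l.
have ratN : rational_on S N.
  have : rational_on S (fun y => 2^-1 * ((f y ^+ 2 + l y ^+ 2) -
      (f y ^+ 2) ^+ 2 * ((f y ^+ 2 / (f y - l y)) ^+ 2)^-1)).
    apply: rationalZ; apply: rationalB.
      by apply: rationalD => //; exact: rationalX.
    apply: rationalM; first exact: rationalX.
    apply: rationalV ratM => y Sy.
    by rewrite expf_neq0// mulf_neq0 ?expf_neq0 ?invr_eq0 ?f0 ?fl.
  apply: rational_ext => y; rewrite inE => Sy.
  have := f0 y Sy; have := fl y Sy; rewrite -/(l y) => h1 h2.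
  rewrite -[RHS]/(f y * l y); field.
  by rewrite h1 h2.
pose L := 'D_e N.
have [ratL _] := rational_derive e oS ratN; rewrite -/L in ratL.
have [ratdA _] := rational_derive e oS ratA.
have LE y : S y -> L y = f y * r 0 m + l y * 'D_e f y.
  move=> Sy; have dl := is_derive_linear r y e; rewrite le in dl.
  have D := is_deriveM (derivableP (df y e Sy)) dl.
  by rewrite /L (@derive_val _ _ _ _ _ _ _ D).
have dAE y : S y -> 'D_e (fun y => f y ^+ 2) y = 2 * (f y * 'D_e f y).
  move=> Sy; have d := derivableP (df y e Sy); have D := is_deriveM d d.
  have -> : (fun y => f y ^+ 2) = f * f by apply/funext => z; rewrite expr2.
  by rewrite (@derive_val _ _ _ _ _ _ _ D) mulr_natl mulr2n.
(* This is [f * L] with [f * 'D_e f] replaced by half the derivative of [f ^+ 2], which makes its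
   rationality visible. *)
pose K y := r 0 m * f y ^+ 2 + l y * (2^-1 * 'D_e (fun y => f y ^+ 2) y).
have KE y : S y -> K y = f y * L y.
  by move=> Sy; rewrite /K dAE// LE//; field.
have ratK : rational_on S K.
  by apply: rationalD; [exact: rationalZ|apply: rationalM => //; exact: rationalZ].
have den y : S y -> l y ^+ 2 + L y ^+ 2 != 0.
  move=> Sy; rewrite paddr_eq0 ?sqr_ge0// !sqrf_eq0; apply/negP => /andP[/eqP l0].
  by rewrite LE// l0 mul0r addr0 mulf_eq0 (negbTE rm) orbF (negbTE (f0 y Sy)).
(* Since [N = f * l] and [K = f * L] on [S], the numerator is [f] times the denominator. *)
have : rational_on S (fun y => (N y * l y + K y * L y) * (l y ^+ 2 + L y ^+ 2)^-1).
  apply: rationalM; first by apply: rationalD; exact: rationalM.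
  by apply: rationalV => //; apply: rationalD; exact: rationalX.
apply: rational_ext => y; rewrite inE => Sy; rewrite KE//.
rewrite (_ : N y * l y + _ = f y * (l y ^+ 2 + L y ^+ 2)) ?mulfK ?den//.
by rewrite -[N y]/(f y * l y); ring.
Qed.

End Core.

(** * Tangent vectors in charts *)

Section Charts.
Context {R : realType} {n : nat} {M : manifold R n}.
Local Notation vec := 'rV[R]_n.
Implicit Types (i j : atlas M) (x : M) (v : tangent M) (u y : vec).

Lemma tangent_ext v w : base v = base w -> Defs.comp v = Defs.comp w -> v = w.
Proof.
case: v w => [x c p] [x' c' p'] /= ? ?; subst x' c'.
by congr Tangent; exact: Prop_irrelevance.
Qed.

Lemma cimage_dom i u : cimage i u -> dom i (chartV i u) /\ chart i (chartV i u) = u.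
Proof. by move=> [x ix <-]; rewrite chartK. Qed.

(** [transition i i] is known to be the identity only on the chart image; that set is open, so the
    derivative sees nothing else. *)
Lemma diff_transition_id i x y : dom i x -> 'd (transition i i) (chart i x) y = y.
Proof.
move=> ix; rewrite -deriveE; last exact: transition_differentiable.
rewrite -[RHS](derive_id (chart i x) y).
have cx : cimage i (chart i x) by exists x.
have h : {in cimage i, transition i i =1 id}.
  by move=> u; rewrite inE => /cimage_dom[].
have := near_open_eq (@chart_open _ _ M i) cx h.
exact: near_eq_derive.
Qed.

Lemma comp_tvec i j u y : cimage i u -> dom j (chartV i u) ->
  Defs.comp (tvec i (u, y)) j = 'd (transition i j) u y.
Proof.
move=> /cimage_dom[ix e] jx.
by rewrite /= /vec_comp asboolT ?e.
Qed.

Lemma comp_tvec_same i u y : cimage i u -> Defs.comp (tvec i (u, y)) i = y.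
Proof.
move=> [x ix <-]; rewrite comp_tvec ?chartK//; last by exists x.
exact: diff_transition_id.
Qed.

Lemma comp_law v i j : dom i (base v) -> dom j (base v) ->
  Defs.comp v j = 'd (transition i j) (chart i (base v)) (Defs.comp v i).
Proof. by case: (compP v) => _; exact. Qed.

Lemma tvec_coords j v : dom j (base v) -> tvec j (coords j v) = v.
Proof.
move=> jv; apply: tangent_ext; first by rewrite /= chartK.
apply/funext => k; rewrite /= /vec_comp /coords /= chartK//.
have [kv|nkv] := pselect (dom k (base v)); first by rewrite asboolT// -comp_law.
by rewrite asboolF => [|[]//]; have [-> //] := compP v.
Qed.

(** Components in charts around the base point are related by linear maps, and those in other charts
    are zero by convention, so [comp v j = 0] forces all of them to vanish. *)
Lemma slit_comp v j : dom j (base v) -> slit v <-> Defs.comp v j != 0.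
Proof.
move=> jv; split=> [[k]|]; last by exists j.
apply: contra_neq => vj0; have [kv|nkv] := pselect (dom k (base v)).
  by rewrite (comp_law jv kv) vj0 linear0.
by have [-> //] := compP v.
Qed.

Lemma slit_tvec i u y : cimage i u -> slit (tvec i (u, y)) <-> y != 0.
Proof.
move=> ciu; have [ix _] := cimage_dom ciu.
have := @slit_comp (tvec i (u, y)) i ix.
by rewrite comp_tvec_same.
Qed.

Lemma in_chart_slit i : in_chart (@slit R n M) i = slit_chart i.
Proof.
rewrite predeqE => -[u y]; split=> -[/= ciu] h; split => //=.
  exact/(slit_tvec y ciu).
exact/(slit_tvec y ciu).
Qed.

Lemma open_slit_chart i : open (@slit_chart R n M i).
Proof.
have -> : slit_chart i = (fst @^-1` cimage i) `&` (snd @^-1` ~` [set 0 : vec]).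
  by rewrite predeqE => -[u y] /=; split=> -[? /eqP].
apply: openI.
  apply: open_comp; last exact: chart_open.
  by move=> z _; exact: cvg_fst.
apply: open_comp; first by move=> z _; exact: cvg_snd.
apply: closed_openC; apply: accessible_closed_set1; apply: hausdorff_accessible.
exact: norm_hausdorff.
Qed.

Lemma tscale_tvec i u y (c : R) : cimage i u ->
  tscale c (tvec i (u, y)) = tvec i (u, c *: y).
Proof.
move=> ciu; have [ix e] := cimage_dom ciu; apply: tangent_ext => //.
apply/funext => k; rewrite /= /vec_comp; case: asboolP => _; last by rewrite scaler0.
by rewrite linearZ.
Qed.

End Charts.

(** * Homogeneous metric functions on conic domains *)

Section Homogeneous.
Context {R : realType} {n : nat} {M : manifold R n}.
Local Notation vec := 'rV[R]_n.
Local Notation e_ k := (delta_mx 0 k : 'rV[R]_n).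
Implicit Types (i j : atlas M) (v : tangent M) (u y : vec) (D : set (tangent M))
  (H : tangent M -> R).

Lemma fibreE D i u : cimage i u -> fibre D i u = [set y | in_chart D i (u, y)].
Proof. by move=> ciu; rewrite predeqE => y; split=> [Dy|[]//]; split. Qed.

Lemma fibre_open D i u : topen D -> cimage i u -> open (fibre D i u).
Proof. by move=> oD ciu; rewrite fibreE//; apply: open_fibre; exact: oD. Qed.

Lemma topen_slit : topen (@slit R n M).
Proof. by move=> i; rewrite in_chart_slit; exact: open_slit_chart. Qed.

Lemma smooth_energy D H i : topen D -> smooth_fun H D ->
  smooth_on (energy H i) (in_chart D i).
Proof. by move=> oD sH; apply: smooth_half_sqr; [exact: oD|exact: sH]. Qed.

Lemma fibre_differentiable D H i u y w : smooth_fun H D -> cimage i u ->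
  fibre D i u y -> derivable (fun y => H (tvec i (u, y))) y w.
Proof.
move=> sH ciu Dy.
have zD : in_chart D i (u, y) by [].
by have [d _] := smooth_fibre_C1 (sH i) zD; exact: d.
Qed.

(** The energy is homogeneous of degree 2, and twice the energy is the square of [H]. *)
Lemma fibre_energy D H i u : topen D -> smooth_fun H D -> cimage i u ->
  (forall (c : R) v, 0 < c -> D v -> H (tscale c v) = c * H v) ->
  forall y, fibre D i u y ->
  (forall k, \sum_l y 0 l * hess (energy H i) (u, y) k l =
             'D_(e_ k) (fun y => energy H i (u, y)) y) /\
  \sum_k y 0 k * 'D_(e_ k) (fun y => energy H i (u, y)) y = H (tvec i (u, y)) ^+ 2.
Proof.
move=> oD sH ciu hH y Dy; have sE := smooth_energy i oD sH.
have zD : in_chart D i (u, y) by [].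
have hE (t : R) y' : 0 < t -> in_chart D i (u, y') ->
    energy H i (u, t *: y') = t ^+ 2 * energy H i (u, y').
  by move=> t0 [_ Dy']; rewrite /energy -tscale_tvec// hH// exprMn mulrA.
have [E1 E2] := euler_hess (open_fibre (u := u) (oD i)) (smooth_fibre_C1 sE)
  (fun w => smooth_fibre_C1_derive w (oD i) sE) hE zD.
split; first by move=> k; rewrite (hess_fhess (oD i) sE zD).
by rewrite E2 /energy; field.
Qed.

(** By the two Euler identities together, [H ^+ 2] is the Hessian of the energy evaluated twice on
    [y], a polynomial in [y] and the Hessian entries. *)
Lemma rational_sqr D H i u : topen D -> smooth_fun H D -> cimage i u ->
  (forall (c : R) v, 0 < c -> D v -> H (tscale c v) = c * H v) ->
  forall S, S `<=` fibre D i u ->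
  (forall k l, rational_on S (fun y => hess (energy H i) (u, y) k l)) ->
  rational_on S (fun y => H (tvec i (u, y)) ^+ 2).
Proof.
move=> oD sH ciu hH S SD rH.
have : rational_on S
    (fun y => \sum_k y 0 k * \sum_l y 0 l * hess (energy H i) (u, y) k l).
  apply: rational_sum => k; apply: rationalM; first exact: rational_coord.
  by apply: rational_sum => l; apply: rationalM => //; exact: rational_coord.
apply: rational_ext => y; rewrite inE => /SD Dy.
have [E1 <-] := fibre_energy oD sH ciu hH Dy.
by apply: eq_bigr => k _; rewrite E1.
Qed.

Lemma rational_metric_hess D H i u k l : rational_metric D H -> cimage i u ->
  rational_on (fibre D i u) (fun y => hess (energy H i) (u, y) k l).
Proof.
move=> [theta [a [[_ _ ha ra] rtheta]]] ciu.
apply: rational_ext (rationalM (rtheta i u ciu) (ra i u k l ciu)) => y.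
rewrite inE => Dy; have [-> _ _] := ha i (u, y) (conj ciu Dy).
by rewrite mxE.
Qed.

Lemma hess_unit D H i z : topen D -> smooth_fun H D -> in_chart D i z ->
  max_rank (ddJ (energy H i) z) -> hess (energy H i) z \in unitmx.
Proof.
case: z => u y oD sH Dz mr.
rewrite (hess_fhess (oD i) (smooth_energy i oD sH) Dz).
exact: max_rank_fhess (oD i) (smooth_energy i oD sH) Dz mr.
Qed.

(** The factor can be 1 and the matrix the Hessian itself: rational as a second derivative,
    symmetric by [rational_deriveC], invertible by maximal rank. *)
Lemma rational_rational_metric D H : topen D -> smooth_fun H D ->
  (forall i z, in_chart D i z -> max_rank (ddJ (energy H i) z)) ->
  rational_in_y D H -> rational_metric D H.
Proof.
move=> oD sH mr ratH; exists (fun=> 1), (fun i z => hess (energy H i) z).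
have ratE i u : cimage i u -> rational_on (fibre D i u) (fun y => energy H i (u, y)).
  move=> ciu; apply: rationalM; last exact: rational_cst.
  exact: rationalX (ratH i u ciu).
split; last by move=> i u ciu; exact: rational_cst.
split=> [//|i|i z Dz|i u k l ciu].
- exact: smooth_cst.
- split; [by rewrite scale1r| |exact: hess_unit Dz (mr i z Dz)].
  case: z Dz => u y Dz; have [ciu Dy] := Dz.
  rewrite (hess_fhess (oD i) (smooth_energy i oD sH) Dz).
  apply/matrixP => k l; rewrite !mxE.
  exact: rational_deriveC (fibre_open oD ciu) (ratE i u ciu) Dy.
- have oS := fibre_open oD ciu.
  have [rl _] := rational_derive (e_ l) oS (ratE i u ciu).
  have [rkl _] := rational_derive (e_ k) oS rl.
  apply: rational_ext rkl => y; rewrite inE => Dy.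
  by rewrite (hess_fhess (oD i) (smooth_energy i oD sH) (conj ciu Dy)) mxE.
Qed.

(* By Euler [g(eta, .) = F dF], which would vanish where [F] does. *)
Lemma finsler_neq0 F v : finsler F -> slit v -> F v != 0.
Proof.
move=> [_ sF _ hF mr] sv; apply/eqP => Fv0.
have [i iv] := dom_cover (base v).
have [u [y [ciu ve]]] : exists u y, cimage i u /\ tvec i (u, y) = v.
  exists (chart i (base v)), (Defs.comp v i); split; first by exists (base v).
  exact: tvec_coords.
have y0 : y != 0 by apply/(slit_tvec y ciu); rewrite ve.
have Dz : in_chart slit i (u, y) by split=> //; rewrite /= ve.
have [E1 _] := fibre_energy topen_slit sF ciu (fun c v c0 _ => hF c v c0) Dz.2.
have dF w : derivable (fun y' => F (tvec i (u, y'))) y w.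
  exact: fibre_differentiable sF ciu Dz.2.
have E0 k : \sum_l y 0 l * hess (energy F i) (u, y) k l = 0.
  rewrite E1; have D := is_deriveX 2 (derivableP (dF (e_ k))).
  have -> : (fun y => energy F i (u, y)) = 2^-1 \*: (fun y => F (tvec i (u, y))) ^+ 2.
    by apply/funext => y'; rewrite /energy mulrC.
  have D2 := is_deriveZ 2^-1 D.
  by rewrite (@derive_val _ _ _ _ _ _ _ D2) /= ve Fv0 expr1 mulr0 scale0r scaler0.
have U : hess (energy F i) (u, y) \in unitmx.
  have Oz : slit_chart i (u, y) by rewrite -in_chart_slit.
  exact: hess_unit topen_slit sF Dz (mr i _ Oz).
have : hess (energy F i) (u, y) *m y^T = 0.
  apply/matrixP => k l; rewrite !mxE -[RHS](E0 k); apply: eq_bigr => m _.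
  by rewrite !mxE mulrC (ord1 l).
move=> /(congr1 (mulmx (invmx (hess (energy F i) (u, y))))).
rewrite mulKmx// mulmx0 => /(congr1 trmx); rewrite trmxK trmx0 => y00.
by rewrite y00 eqxx in y0.
Qed.

End Homogeneous.

(** * The function [Phi] as a nonzero linear form on each fibre *)

Section Covector.
Context {R : realType} {n : nat} {M : manifold R n}.
Local Notation vec := 'rV[R]_n.
Local Notation e_ k := (delta_mx 0 k : 'rV[R]_n).
Implicit Types (i j : atlas M) (v : tangent M) (u y : vec) (D : set (tangent M)).

(** [Phi_of] is computed in [chart_at] of the base point, so the linear form is found there first.
    Its coefficients are vertically constant, and connectedness of the fibre makes them common to
    all of [D] over [x]. *)
Lemma Phi_covector (F : tangent M -> R)
    (G : atlas M -> 'rV[R]_n * 'rV[R]_n -> 'rV[R]_n * 'rV[R]_n)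
    (phi : tangent M -> tangent M) D x :
  finsler F -> geodesic_spray F G -> concurrent F G phi -> conic_domain D ->
  exists2 c : vec, c != 0 & forall v, D v -> base v = x ->
    Phi_of F phi v = \sum_k Defs.comp v (chart_at x) 0 k * c 0 k.
Proof.
move=> [_ sF _ hF mr] [[sG _] spray] [[bphi sphi] phi0 cphi].
move=> [[Dslit _] oD _ surjD connD].
set j := chart_at x; have jx : dom j x by exact: projT2 (cid (dom_cover x)).
have [v0 Dv0 bv0] := surjD x.
pose u := chart j x; have cju : cimage j u by exists x.
have Dcomp v : D v -> base v = x ->
    fibre D j u (Defs.comp v j) /\ tvec j (u, Defs.comp v j) = v.
  move=> Dv bv; have jv : dom j (base v) by rewrite bv.
  have := tvec_coords jv; rewrite /coords bv -/u => e.
  by rewrite /fibre /= e.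
have slitO y : fibre D j u y -> slit_chart j (u, y).
  by move=> Dy; rewrite -in_chart_slit; split=> //; exact: Dslit.
have oO := @open_slit_chart _ _ M j.
have sE : smooth_on (energy F j) (slit_chart j).
  by rewrite -in_chart_slit; exact: smooth_energy topen_slit sF.
have JG z : slit_chart j z -> Jvert (G j z) = liouville z.
  by case: (spray j) => + _ _; exact.
pose phij := pi_comp phi j.
have [Dy0 ve0] := Dcomp v0 Dv0 bv0; set y0 := Defs.comp v0 j in Dy0 ve0.
pose g w y := gmetric (energy F j) (u, y) (phij (u, y)) w.
(* The coefficients are sampled at one vector of the fibre, which exists because [D] projects onto
   [M]. *)
pose c : vec := \row_k g (e_ k) y0.
have gE y w : fibre D j u y -> g w y = \sum_k w 0 k * c 0 k.
  move=> Dy; have ck k : g (e_ k) y = c 0 k.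
    rewrite [RHS]mxE.
    exact: (concurrent_covector_const (e_ k) oO sE (sG j) (sphi j) JG (cphi j)
      (fibre_open oD cju) (connD j u cju) slitO Dy Dy0).
  rewrite /g (gmetric_sumr _ _ oO sE (slitO y Dy)).
  by apply: eq_bigr => k _; rewrite -ck.
exists c; last first.
  move=> v Dv bv; have [Dy ve] := Dcomp v Dv bv.
  rewrite -(gE _ _ Dy) /Phi_of /assoc_form /metric bv -/j /g /phij /pi_comp ve.
  by rewrite /coords bv.
(* If [c] vanished, [phi] at [y0] would lie in the kernel of the invertible Hessian, although [phi]
   is nowhere zero. *)
apply/eqP => c0.
pose A := fhess (fun y => energy F j (u, y)) y0.
have U : A \in unitmx.
  exact: max_rank_fhess oO sE (slitO _ Dy0) (mr j _ (slitO _ Dy0)).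
have : phij (u, y0) *m A = 0.
  apply/rowP => k; have := gE y0 (e_ k) Dy0; rewrite /g.
  rewrite (gmetric_fhess _ _ oO sE (slitO _ Dy0)) -/A c0.
  rewrite big1 => [|l _]; last by rewrite [X in _ * X]mxE mulr0.
  move: (phij (u, y0) *m A) => q; rewrite mxE (bigD1 k)//= [X in _ * X]mxE mxE !eqxx.
  rewrite mulr1 big1 ?addr0 => [->|l lk]; first by rewrite mxE.
  by rewrite [X in _ * X]mxE mxE eqxx (negbTE lk) mulr0.
move=> /(congr1 (mulmxr (invmx A))); rewrite /= mulmxK// mul0mx => p0.
have sv0 : slit v0 by exact: Dslit.
have jp : dom j (base (phi v0)) by rewrite bphi// bv0.
have /(slit_comp jp) := phi0 _ sv0.
by rewrite -ve0 -/(pi_comp phi j (u, y0)) -/phij p0 eqxx.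
Qed.

(** Rationality is tested in every chart, so the covector is pulled back along the Jacobian [T] from
    chart [i] to [chart_at]; it stays nonzero because [T] is onto. *)
Lemma Phi_linear (F : tangent M -> R)
    (G : atlas M -> 'rV[R]_n * 'rV[R]_n -> 'rV[R]_n * 'rV[R]_n)
    (phi : tangent M -> tangent M) D i u :
  finsler F -> geodesic_spray F G -> concurrent F G phi -> conic_domain D ->
  cimage i u ->
  exists2 r : vec, r != 0 & forall y, fibre D i u y ->
    Phi_of F phi (tvec i (u, y)) = \sum_k y 0 k * r 0 k.
Proof.
move=> fF gG cphi cD ciu; have [ix eu] := cimage_dom ciu.
set x := chartV i u in ix eu.
have [c c0 cP] := Phi_covector x fF gG cphi cD.
set j := chart_at x in cP; have jx : dom j x by exact: projT2 (cid (dom_cover x)).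
pose T y : vec := 'd (transition i j) u y.
pose l y := \sum_k T y 0 k * c 0 k.
have TE y : T y = \sum_m y 0 m *: T (e_ m).
  rewrite {1}[y]row_sum_delta /T linear_sum; apply: eq_bigr => m _.
  by rewrite linearZ.
pose r : vec := \row_m l (e_ m).
have lE y : l y = \sum_k y 0 k * r 0 k.
  rewrite /l TE; under eq_bigr do rewrite summxE mulr_suml.
  rewrite exchange_big; apply: eq_bigr => m _; rewrite mxE mulr_sumr.
  by apply: eq_bigr => k _; rewrite mxE mulrA.
exists r; last first.
  by move=> y Dy; rewrite (cP _ Dy erefl) -lE /l comp_tvec.
apply: contra_neq c0 => r0; apply/rowP => k; rewrite mxE.
(* The inverse Jacobian gives a preimage of [e_ k] under [T]; then [l e] is the coefficient [c 0 k],
   and [r = 0] makes it vanish. *)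
pose e := 'd (transition j i) (chart j x) (e_ k).
have Te : T e = e_ k.
  have h := diff_transition_id (e_ k) jx.
  by rewrite (transition_comp jx ix jx) eu in h.
have := lE e; rewrite r0 [RHS]big1 => [|m _]; last by rewrite [X in _ * X]mxE mulr0.
rewrite /l Te (bigD1 k)//= mxE !eqxx mul1r big1 ?addr0// => m mk.
by rewrite mxE eqxx (negbTE mk) mul0r.
Qed.

End Covector.

(** * The two implications, fibre by fibre *)

Theorem theorem4p6 (R : realType) (n : nat) (M : manifold R n)
    (F : tangent M -> R)
    (G : atlas M -> 'rV[R]_n * 'rV[R]_n -> 'rV[R]_n * 'rV[R]_n)
    (phi : tangent M -> tangent M)
    (F_finsler : finsler F) (G_spray : geodesic_spray F G)
    (phi_concurrent : concurrent F G phi) :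
  let Phi := Phi_of F phi in
  let p2 := p2_of F phi in
  let D := [set v : tangent M | slit v /\ Phi v < F v] in
  let Fhat := fun v : tangent M => F v ^+ 2 / (F v - Phi v) in
  conic_pseudo_finsler D Fhat ->
  (forall v, D v -> F v * (1 + 2 * p2 v) - 3 * Phi v != 0) ->
  rational_metric slit F ->
  (rational_in_y D F <-> rational_metric D Fhat).
Proof.
move=> Phi p2 D Fhat [cD [_ sFhat hFhat mrFhat]] _ ratF.
have [[Dslit _] oD _ _ _] := cD; have [_ sF _ hF _] := F_finsler.
have Fdiff v : D v -> F v - Phi v != 0 by move=> [_ lt]; rewrite subr_eq0 gt_eqF.
have fibreS i u : fibre D i u `<=` fibre slit i u by move=> y [].
split=> [ratFy|ratFhat].
  (* It suffices that [Fhat] itself is rational: it is a quotient built from [F] and a linear form,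
     with denominator nonzero on [D]. *)
  apply: rational_rational_metric => // i u ciu.
  have [r _ rP] := Phi_linear F_finsler G_spray phi_concurrent cD ciu.
  apply: rationalM; first exact: rationalX (ratFy i u ciu).
  apply: rationalV => [y Dy|]; first exact: Fdiff.
  apply: rationalB; first exact: ratFy.
  apply: rational_ext (rational_linear _ r) => y; rewrite inE => Dy.
  by rewrite -rP.
move=> i u ciu.
have [r r0 rP] := Phi_linear F_finsler G_spray phi_concurrent cD ciu.
apply: (@rational_of_matsumoto _ _ _ _ r) => //.
- exact: fibre_open.
- by move=> y v Dy; apply: fibre_differentiable sF ciu (fibreS _ _ _ Dy).
- by move=> y [sy _]; exact: finsler_neq0.
- by move=> y Dy; rewrite -rP//; exact: Fdiff.
(* The Hessian of the energy of [F] is rational on the whole slit fibre, and this is restricted to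
   the fibre of [D]; for [Fhat] everything already takes place on [D]. *)
- apply: (rational_sqr topen_slit sF ciu) (fibreS _ _) _ => [c v c0 _|k l].
    exact: hF.
  exact: rational_sub (fibreS i u) (rational_metric_hess _ _ ratF ciu).
- have h := rational_sqr oD sFhat ciu hFhat (@subset_refl _ _)
    (fun k l => rational_metric_hess k l ratFhat ciu).
  by apply: rational_ext h => y; rewrite inE => Dy; rewrite /Fhat -rP.
Qed.
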